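(* For integers $3\le k\le m<\infty$, every variety in the interval $$[\mathsf V(S_c^*(a_1\cdots a_k)),\ \mathsf V(S_c^*(a_1\cdots a_m))]$$ is nonfinitely based.
   Context: An ai-semiring (additively idempotent semiring) is an algebra $(S,+,\cdot)$ with two binary operations such that $(S,+)$ is a commutative idempotent semigroup, $(S,\cdot)$ is a semigroup, and both distributive laws hold. The signature is $(+,\cdot)$, with no constants. $\mathsf V(S)$ denotes the variety generated by $S$. For varieties $\mathcal A\subseteq\mathcal B$, the interval $[\mathcal A,\mathcal B]$ consists of all varieties $\mathcal W$ with $\mathcal A\subseteq\mathcal W\subseteq\mathcal B$. A variety is finitely based if its identities all follow from a finite set of them; otherwise it is nonfinitely based. For $k\ge1$ and distinct letters $a_1,a_2,\dots$, the semiring $S_c^*(a_1\cdots a_k)$ has as its nonzero elements all nonempty square-free commutative words on $\{a_1,\ldots,a_k\}$, together with an element $0$ absorbing for both addition and multiplication. For nonzero $u,v$: $u+v$ is the square-free word whose set of letters is the union of the sets of letters of $u$ and $v$; $u\cdot v$ is the square-free word $uv$ if $u$ and $v$ have no letter in common, and $u\cdot v=0$ otherwise. For $k\le m$, $S_c^*(a_1\cdots a_k)$ is a subsemiring of $S_c^*(a_1\cdots a_m)$. *)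

(* Defs.v *)
From mathcomp Require Import all_boot.
From Stdlib Require Import ClassicalEpsilon FunctionalExtensionality.

Set Implicit Arguments.
Unset Strict Implicit.
Unset Printing Implicit Defensive.

(* Algebras of signature (+, .) without constants. Carriers are nonempty, as
   usual in universal algebra; the operations satisfy no laws a priori. *)
Record algebra := Algebra {
  carrier :> Type;
  add : carrier -> carrier -> carrier;
  mul : carrier -> carrier -> carrier;
  carrier_inhabited : inhabited carrier
}.

Record ai_semiring (A : algebra) : Prop := AiSemiring {
  ai_addA : associative (@add A);
  ai_addC : commutative (@add A);
  ai_addI : idempotent_op (@add A);
  ai_mulA : associative (@mul A);
  ai_mulDl : left_distributive (@mul A) (@add A);
  ai_mulDr : right_distributive (@mul A) (@add A)
}.

Definition is_hom (A B : algebra) (h : A -> B) : Prop :=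
  {morph h : x y / add x y} /\ {morph h : x y / mul x y}.

Lemma prod_inhabited (I : Type) (F : I -> algebra) :
  inhabited (forall i, F i).
Proof.
exact: (inhabits (fun i => epsilon (carrier_inhabited (F i)) (fun=> True))).
Qed.

Definition prod_algebra (I : Type) (F : I -> algebra) : algebra :=
  @Algebra (forall i, F i)
    (fun x y i => add (x i) (y i)) (fun x y i => mul (x i) (y i))
    (prod_inhabited F).

(* Subalgebras and homomorphic images are taken up to isomorphism. *)
Record is_variety (W : algebra -> Prop) : Prop := IsVariety {
  variety_sub : forall (A B : algebra) (h : B -> A),
    is_hom h -> injective h -> W A -> W B;
  variety_image : forall (A B : algebra) (h : A -> B),
    is_hom h -> (forall b, exists a, h a = b) -> W A -> W B;
  variety_prod : forall (I : Type) (F : I -> algebra),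
    (forall i, W (F i)) -> W (prod_algebra F)
}.

Definition subclass (V W : algebra -> Prop) : Prop := forall A, V A -> W A.

Definition variety_of (S : algebra) : algebra -> Prop :=
  fun A => forall W, is_variety W -> W S -> W A.

Definition in_interval (V1 V2 W : algebra -> Prop) : Prop :=
  [/\ is_variety W, subclass V1 W & subclass W V2].

Inductive term :=
| Var of nat
| Add of term & term
| Mul of term & term.

Fixpoint eval (A : algebra) (v : nat -> A) (t : term) : A :=
  match t with
  | Var n => v n
  | Add s t => add (eval v s) (eval v t)
  | Mul s t => mul (eval v s) (eval v t)
  end.

Definition identity : Type := (term * term)%type.

Definition satisfies (A : algebra) (e : identity) : Prop :=
  forall v : nat -> A, eval v e.1 = eval v e.2.

Definition identity_of (W : algebra -> Prop) (e : identity) : Prop :=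
  forall A, W A -> satisfies A e.

(* Consequence over all algebras of the signature. Working modulo the
   ai-semiring axioms would give the same notion of finite basis, as those
   axioms are finitely many identities and may be listed in Sigma. *)
Definition follows (Sigma : seq identity) (e : identity) : Prop :=
  forall A : algebra,
    (forall e', List.In e' Sigma -> satisfies A e') -> satisfies A e.

Definition finitely_based (W : algebra -> Prop) : Prop :=
  exists Sigma : seq identity,
    (forall e, List.In e Sigma -> identity_of W e) /\
    (forall e, identity_of W e -> follows Sigma e).

(* A nonempty square-free commutative word on a_1, ..., a_k is determined by
   its (nonempty) set of letters; the letter a_(i+1) is the index i : 'I_k. *)
Definition word (k : nat) : Type := {A : {set 'I_k} | A != set0}.

Lemma word_union_subproof k (u v : word k) : val u :|: val v != set0.
Proof. by rewrite setU_eq0 negb_and (valP u). Qed.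

Definition word_union k (u v : word k) : word k :=
  exist _ (val u :|: val v) (word_union_subproof u v).

(* [None] is the element 0. *)
Definition Sc_carrier (k : nat) : Type := option (word k).

Definition Sc_add k (x y : Sc_carrier k) : Sc_carrier k :=
  match x, y with
  | Some u, Some v => Some (word_union u v)
  | _, _ => None
  end.

Definition Sc_mul k (x y : Sc_carrier k) : Sc_carrier k :=
  match x, y with
  | Some u, Some v =>
      if [disjoint val u & val v] then Some (word_union u v) else None
  | _, _ => None
  end.

(* S_c^*(a_1 ... a_k); for k = 0 it is just {0}. *)
Definition Sc (k : nat) : algebra :=
  @Algebra (Sc_carrier k) (@Sc_add k) (@Sc_mul k) (inhabits None).

Lemma val_word_union k (u v : word k) : val (word_union u v) = val u :|: val v.
Proof. by []. Qed.

Lemma disjointU k (A B C : {set 'I_k}) :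
  ([disjoint A :|: B & C] = [disjoint A & C] && [disjoint B & C]) *
  ([disjoint A & B :|: C] = [disjoint A & B] && [disjoint A & C]).
Proof. by rewrite -!setI_eq0 setIUl setIUr !setU_eq0. Qed.

Lemma Sc_ai_semiring k : ai_semiring (Sc k).
Proof.
have eqS (u v : word k) : val u = val v -> Some u = Some v.
  by move=> /val_inj ->.
split.
- by case=> [u|] [v|] [w|] //=; apply: eqS; rewrite /= setUA.
- by case=> [u|] [v|] //=; apply: eqS; rewrite /= setUC.
- by case=> [u|] //=; apply: eqS; rewrite /= setUid.
- case=> [u|] [v|] [w|] //=; try by case: ifP.
  case vw: [disjoint val v & val w]; case uv: [disjoint val u & val v] => //;
    rewrite /Sc_mul ?val_word_union ?disjointU ?uv ?vw ?andbF ?andbT //=.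
  by case: ifP => // _; apply: eqS; rewrite /= setUA.
- case=> [u|] [v|] [w|] //=; try by case: ifP.
  rewrite disjointU.
  case: [disjoint val u & val w]; case: [disjoint val v & val w] => //=.
  by apply: eqS; rewrite /= setUUl.
- case=> [u|] [v|] [w|] //=; try by case: ifP.
  rewrite disjointU.
  case: [disjoint val u & val v]; case: [disjoint val u & val w] => //=.
  by apply: eqS; rewrite /= setUUr.
Qed.

Lemma variety_of_is_variety S : is_variety (variety_of S).
Proof.
split.
- move=> A B h hh inj VA W WV WS; exact: (variety_sub WV hh inj (VA W WV WS)).
- move=> A B h hh sur VA W WV WS.
  exact: (variety_image WV hh sur (VA W WV WS)).
- by move=> I F VF W WV WS; apply: variety_prod => // i; apply: VF.
Qed.

Lemma ai_semiring_is_variety : is_variety ai_semiring.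
Proof.
split.
- move=> A B h [hD hM] inj [aA aC aI mA mDl mDr].
  split; repeat move=> ?; apply: inj;
    by rewrite ?(hD, hM); rewrite ?(aA, aI, mA, mDl, mDr) // aC.
- move=> A B h [hD hM] sur [aA aC aI mA mDl mDr].
  split; repeat (let b := fresh "b" in move=> b; case: (sur b) => ? <-);
    by rewrite -?(hD, hM) ?(aA, aI, mA, mDl, mDr) // aC.
- move=> I F aiF.
  split; repeat move=> ?; apply: functional_extensionality_dep => i /=;
    case: (aiF i) => aA aC aI mA mDl mDr;
    by rewrite ?(aA, aI, mA, mDl, mDr) // aC.
Qed.

Lemma variety_of_Sc_ai_semiring k : subclass (variety_of (Sc k)) ai_semiring.
Proof.
by move=> A; apply; [exact: ai_semiring_is_variety | exact: Sc_ai_semiring].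
Qed.

Lemma Sc_variety_mono k m : k <= m ->
  subclass (variety_of (Sc k)) (variety_of (Sc m)).
Proof.
move=> km A VA W WV WS; apply: VA => //.
pose f (i : 'I_k) := widen_ord km i.
have f_inj : injective f by move=> i j /(congr1 val) /= /val_inj.
have ne (u : word k) : f @: val u != set0.
  by case/set0Pn: (valP u) => i iu; apply/set0Pn; exists (f i); apply: imset_f.
pose g (u : word k) : word m := exist _ (f @: val u) (ne u).
apply: (variety_sub WV (h := omap g : Sc k -> Sc m)) => //.
- split=> [] [u|] [v|] //=.
    by congr Some; apply: val_inj; rewrite /= imsetU.
  rewrite -!setI_eq0 -imsetI; last by move=> ? ? _ _; apply: f_inj.
  rewrite imset_eq0; case: ifP => //= _.
  by congr Some; apply: val_inj; rewrite /= imsetU.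
- case=> [u|] [v|] //= [] /(imset_inj f_inj) uv.
  by congr Some; apply: val_inj.
Qed.

(* Main.v *)
(* S_c^*(a_1...a_k) is the case of the complete graph K_k of a construction
   that attaches to a graph G an algebra of nonempty vertex sets and 0: sum is
   union, and AB is the union of A and B if every vertex of A is adjacent to
   every vertex of B, and 0 otherwise.  Join two variables of a term when they
   occur together in one of its monomials; a valuation of the term is then
   nonzero exactly when it is a set-valued homomorphism from the resulting
   graph to G, and the value depends only on the set of variables.

   Given l and m, let G have chromatic number above m and all its subgraphs on
   at most l vertices bipartite (a shift graph on (2l+1)-tuples; its chromatic
   number grows by the line digraph argument).  The term t that sums all edges
   of G is 0 under every valuation in S_c^*(a_1...a_m), so t = t^2 holds there;
   it fails in the algebra of G.  On the other hand, an identity p = q of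
   S_c^*(a_1a_2a_3) in at most l variables holds in the algebra of G: a nonzero
   value of p yields a 2-colouring of the graph of p, and the third colour can
   then be given to any two non-adjacent variables, so that q has the same
   variables and no further edges.  Hence no finite set of identities of
   S_c^*(a_1a_2a_3) implies all these identities t = t^2. *)
Require Import Defs.
From mathcomp Require Import all_boot.
From mathcomp Require Import zify.
From Stdlib Require Import ClassicalEpsilon FunctionalExtensionality.

Set Implicit Arguments.
Unset Strict Implicit.
Unset Printing Implicit Defensive.

(** * Identities and generated varieties *)

Lemma eval_hom (A B : algebra) (h : A -> B) (v : nat -> A) t :
  is_hom h -> h (eval v t) = eval (h \o v) t.
Proof.
by case=> hD hM; elim: t => //= s IHs t IHt; rewrite (hD, hM) IHs IHt.
Qed.

(** The easy half of Birkhoff's theorem; it carries identities of [S] over to [variety_of S], which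
    lies in every variety containing [S]. *)
Lemma satisfies_is_variety e : is_variety (fun A => satisfies A e).
Proof.
split.
- by move=> A B h hh inj Ae v; apply: inj; rewrite !eval_hom.
- move=> A B h hh sur Ae v.
  pose w n := proj1_sig (constructive_indefinite_description _ (sur (v n))).
  have -> : v = h \o w.
    apply: functional_extensionality => n /=; rewrite /w.
    by case: constructive_indefinite_description.
  by rewrite -!eval_hom // Ae.
- move=> I F Fe v; apply: functional_extensionality_dep => i.
  pose pr (x : prod_algebra F) := x i.
  have hp : is_hom pr by [].
  by rewrite -!/(pr _) !eval_hom ?Fe.
Qed.

Lemma variety_of_satisfies S e A :
  satisfies S e -> variety_of S A -> satisfies A e.
Proof.
move=> Se /(_ (fun B => satisfies B e)); apply => //.
exact: satisfies_is_variety.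
Qed.

Lemma variety_of_self S : variety_of S S.
Proof. by move=> W. Qed.

(** * Graphs of terms and evaluation in graph algebras *)

Fixpoint vars (t : term) : seq nat :=
  match t with
  | Var x => [:: x]
  | Add s t | Mul s t => vars s ++ vars t
  end.

(* [edge t x y] holds when x precedes y in some monomial of the expansion
   of t. *)
Fixpoint edge (t : term) (x y : nat) : bool :=
  match t with
  | Var _ => false
  | Add s t => edge s x y || edge t x y
  | Mul s t => [|| edge s x y, edge t x y | (x \in vars s) && (y \in vars t)]
  end.

Lemma edge_vars t x y : edge t x y -> x \in vars t /\ y \in vars t.
Proof.
elim: t => //= s IHs t IHt; rewrite !mem_cat.
  by case/orP=> [/IHs|/IHt] [-> ->]; rewrite ?orbT.
by case/or3P=> [/IHs|/IHt|/andP] [-> ->]; rewrite ?orbT.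
Qed.

Section GraphAlgebra.

Variables (n : nat) (e : rel 'I_n).

Definition graph_mul (x y : Sc_carrier n) : Sc_carrier n :=
  match x, y with
  | Some u, Some v =>
      if [forall i in val u, forall j in val v, e i j]
      then Some (word_union u v) else None
  | _, _ => None
  end.

Definition graph_algebra : algebra :=
  @Algebra (Sc_carrier n) (@Sc_add n) graph_mul (inhabits None).

(** The value 0 gets empty support, so that [admissible] can exclude it by nonemptiness. *)
Definition supp (x : Sc_carrier n) : {set 'I_n} :=
  if x is Some u then val u else set0.

Definition admissible (v : nat -> Sc_carrier n) (t : term) : Prop :=
  (forall x, x \in vars t -> supp (v x) != set0) /\
  (forall x y, edge t x y ->
     forall i j, i \in supp (v x) -> j \in supp (v y) -> e i j).

Lemma admissibleD v s t :
  admissible v (Add s t) <-> admissible v s /\ admissible v t.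
Proof.
split=> [[h1 h2]|[[s1 s2] [t1 t2]]].
  by split; split=> [x xs|x y xs]; (apply: h1 || apply: h2);
    rewrite /= ?mem_cat xs ?orbT.
split=> [x|x y] /=; first by rewrite mem_cat => /orP[/s1|/t1].
by case/orP=> [/s2|/t2].
Qed.

Lemma admissibleM v s t :
  admissible v (Mul s t) <->
  [/\ admissible v s, admissible v t &
    forall x y, x \in vars s -> y \in vars t ->
      forall i j, i \in supp (v x) -> j \in supp (v y) -> e i j].
Proof.
split=> [[h1 h2]|[[s1 s2] [t1 t2] st]].
  split; last by move=> x y xs yt; apply: h2; rewrite /= xs yt !orbT.
    by split=> [x xs|x y xs]; (apply: h1 || apply: h2); rewrite /= ?mem_cat xs.
  by split=> [x xs|x y xs]; (apply: h1 || apply: h2);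
    rewrite /= ?mem_cat xs ?orbT.
split=> [x|x y] /=; first by rewrite mem_cat => /orP[/s1|/t1].
by case/or3P=> [/s2|/t2|/andP[/st st' /st']].
Qed.

Variant eval_spec (v : nat -> Sc_carrier n) t : Sc_carrier n -> Prop :=
| EvalSome (u : word n) of admissible v t
    & (forall i, i \in val u <-> exists2 x, x \in vars t & i \in supp (v x)) :
    eval_spec v t (Some u)
| EvalNone of ~ admissible v t : eval_spec v t None.

Lemma mem_word_union v s t (us ut : word n) :
  (forall i, i \in val us <-> exists2 x, x \in vars s & i \in supp (v x)) ->
  (forall i, i \in val ut <-> exists2 x, x \in vars t & i \in supp (v x)) ->
  forall i, i \in val (word_union us ut) <->
    exists2 x, x \in vars s ++ vars t & i \in supp (v x).
Proof.
move=> su tu i; rewrite val_word_union inE; split.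
  by case/orP=> [/su|/tu] [x xi ix]; exists x; rewrite // mem_cat xi ?orbT.
by case=> x; rewrite mem_cat => /orP[] xi ix; apply/orP;
  [left; apply/su|right; apply/tu]; exists x.
Qed.

Lemma eval_graphP (v : nat -> graph_algebra) t : eval_spec v t (eval v t).
Proof.
elim: t => [x|s IHs t IHt|s IHs t IHt] /=.
- case vx: (v x) => [u|]; constructor.
  + by split=> // y /[!inE] /eqP ->; rewrite vx /= (valP u).
  + move=> i; split=> [iu|[y]]; first by exists x; rewrite ?inE ?vx.
    by rewrite inE => /eqP ->; rewrite vx.
  + by case=> /(_ x); rewrite inE eqxx vx eqxx => /(_ isT).
- case: IHs => [us sv su|sN]; last by constructor=> /admissibleD[].
  case: IHt => [ut tv tu|tN]; last by constructor=> /admissibleD[].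
  by constructor; [apply/admissibleD|apply: mem_word_union].
- case: IHs => [us sv su|sN]; last by constructor=> /admissibleM[].
  case: IHt => [ut tv tu|tN]; last by constructor=> /admissibleM[].
  rewrite /graph_mul; case: ifP => [/forall_inP ust|/negP ust]; constructor.
  + apply/admissibleM; split=> // x y xs yt i j ix jy.
    have /forall_inP := ust i (iffRL (su i) (ex_intro2 _ _ x xs ix)).
    by apply; apply/tu; exists y.
  + exact: mem_word_union.
  + move=> /admissibleM[_ _ st]; apply: ust; apply/forall_inP=> i /su[x xs ix].
    by apply/forall_inP=> j /tu[y yt jy]; apply: (st x y).
Qed.

End GraphAlgebra.

Lemma set1_neq0 (T : finType) (x : T) : [set x] != set0.
Proof. by apply/set0Pn; exists x; apply: set11. Qed.

Definition letter n (i : 'I_n) : Sc_carrier n :=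
  Some (exist _ [set i] (set1_neq0 i)).

Lemma supp_letter n (i : 'I_n) : supp (letter i) = [set i].
Proof. by []. Qed.

(** Two words are disjoint exactly when each letter of one is adjacent in the complete graph to each
    letter of the other. *)
Lemma eval_Sc n (v : nat -> Sc n) t :
  eval v t = @eval (graph_algebra [rel i j : 'I_n | i != j]) v t.
Proof.
elim: t => //= [s -> t -> //|s -> t ->].
case: (eval _ s) => //= u; case: (eval _ t) => //= w.
congr (if _ then _ else _); apply/pred0P/forall_inP => [uw i iu|uw i] /=.
  apply/forall_inP=> j jw; apply/eqP=> ij.
  by have := uw i; rewrite /= iu ij jw.
apply/andP=> -[iu iw]; have /forall_inP/(_ i iw) := uw i iu.
by rewrite eqxx.
Qed.

Lemma eval_ScP n (v : nat -> Sc n) t :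
  eval_spec [rel i j | i != j] v t (eval v t).
Proof. by rewrite eval_Sc; apply: eval_graphP. Qed.

(** * Identities in few variables *)

Definition locally_bipartite n (e : rel 'I_n) (l : nat) : Prop :=
  forall S : {set 'I_n}, #|S| <= l ->
  exists b : 'I_n -> bool, {in S &, forall x y, e x y -> b x != b y}.

Section SmallIdentities.

Variables (n : nat) (e : rel 'I_n) (l : nat).
Hypotheses (e_sym : symmetric e) (e_bip : locally_bipartite e l).

(** One vertex chosen from the support of each variable makes at most [l] vertices; their
    2-colouring pulls back to the variables. *)
Lemma admissible_two_coloring (v : nat -> graph_algebra e) p :
  size (vars p) <= l -> admissible e v p ->
  exists b : nat -> bool, forall x y, edge p x y -> b x != b y.
Proof.
move=> pl [p1 p2]; pose h x := [pick i in supp (v x)].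
pose S := [set i in pmap h (vars p)].
have [|c cP] := e_bip (S := S).
  rewrite cardsE (leq_trans (card_size _)) // size_pmap.
  by rewrite (leq_trans (count_size _ _)) // pl.
exists (fun x => oapp c false (h x)) => x y xy.
have hP z : z \in vars p ->
    exists i, [/\ h z = Some i, i \in supp (v z) & i \in S].
  move=> zp; case hz: (h z) => [i|].
    exists i; rewrite inE mem_pmap -hz map_f //; split=> //.
    by move: hz; rewrite /h; case: pickP => // ? ? [<-].
  move: hz; rewrite /h; case: pickP => // v0 _.
  by have /set0Pn[i] := p1 _ zp; rewrite [_ \in _]v0.
have [/hP[i [-> ix iS]] /hP[j [-> jy jS]]] := edge_vars xy.
exact: cP (p2 _ _ xy _ _ ix jy).
Qed.

Lemma small_identity_admissible (v : nat -> graph_algebra e) p q :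
  size (vars p) <= l -> satisfies (Sc 3) (p, q) -> admissible e v p ->
  vars p =i vars q /\ admissible e v q.
Proof.
move=> pl pq pv; have [b bP] := admissible_two_coloring pl pv.
have [p1 p2] := pv.
have transfer (w : nat -> Sc 3) :
    admissible [rel i j | i != j] w p <-> admissible [rel i j | i != j] w q.
  have := pq w; rewrite /=.
  by case: eval_ScP => [up|] wp; case: eval_ScP => [uq|] wq.
pose two x : 'I_3 := if b x then inord 1 else ord0.
have two_edge x y : edge p x y -> two x != two y.
  by move/bP; rewrite /two; case: (b x) (b y) => [] [] //= _;
    rewrite -val_eqE /= inordK.
(* The colour [ord_max] stays free. Variables outside [p] get 0, so any of them in [q] would make
   [q] zero. *)
pose w0 x : Sc 3 := if x \in vars p then letter (two x) else None.
have w0p : admissible [rel i j | i != j] w0 p.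
  split=> [x xp|x y xy i j]; first by rewrite /w0 xp; apply: set1_neq0.
  have [xp yp] := edge_vars xy.
  rewrite /w0 xp yp !supp_letter !inE => /eqP -> /eqP ->; exact: two_edge.
have qp : {subset vars q <= vars p}.
  move=> x xq; have /transfer [/(_ x xq)] := w0p.
  by rewrite /w0; case: ifP => // _; rewrite eqxx.
have pq' : {subset vars p <= vars q}.
  move=> x xp; apply: contraT => xq.
  (* Sending [x] to 0 makes [p] zero but leaves [q] nonzero. *)
  pose w y : Sc 3 := if y == x then None else w0 y.
  have wE y : y \in vars q -> w y = w0 y.
    by rewrite /w; case: eqP => // ->; rewrite (negPf xq).
  have wq : admissible [rel i j | i != j] w q.
    have [q1 q2] := iffLR (transfer w0) w0p.
    split=> [y yq|y z yz]; first by rewrite wE // q1.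
    by have [yq zq] := edge_vars yz; rewrite !wE //; apply: q2.
  by have /transfer [/(_ x xp)] := wq; rewrite /w eqxx eqxx.
split=> [x|]; first by apply/idP/idP => [/pq'|/qp].
have edge_qp x y : edge q x y -> edge p x y || edge p y x.
  move=> xy; apply: contraT => /norP[npxy npyx].
  have [xq yq] := edge_vars xy.
  have loop z : edge p z z -> False by move/bP; rewrite eqxx.
  (* A non-edge x y of p survives: giving x and y the third colour keeps p
     nonzero and kills q. *)
  pose col z : 'I_3 := if (z == x) || (z == y) then ord_max else two z.
  pose w z : Sc 3 := if z \in vars p then letter (col z) else None.
  have two_max z : two z != ord_max.
    by rewrite /two; case: ifP => _; rewrite -val_eqE /= ?inordK.
  have /transfer [_ /(_ x y xy ord_max ord_max)] :
      admissible [rel i j | i != j] w p.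
    split=> [z zp|z t zt i j].
      by rewrite /w zp; apply: set1_neq0.
    have [zp tp] := edge_vars zt.
    rewrite /w zp tp !supp_letter !inE => /eqP -> /eqP -> /=; rewrite /col.
    case: ifP => [|_]; case: ifP => [|_]; last exact: two_edge.
    - by case/orP=> /eqP ty /orP[] /eqP zx; move: zt; rewrite zx ty => zt;
        by [case: (loop _ zt) | rewrite zt in npxy | rewrite zt in npyx].
    - by move=> _; rewrite eq_sym two_max.
    - by move=> _; rewrite two_max.
  by rewrite /w !qp // /col !eqxx orbT /= !inE eqxx => /(_ isT isT).
split=> [x /qp|x y /edge_qp]; first exact: p1.
by case/orP=> /p2 pe i j ix jy; last rewrite e_sym; apply: pe.
Qed.

Lemma graph_algebra_small_identity p q :
  size (vars p) <= l -> size (vars q) <= l ->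
  satisfies (Sc 3) (p, q) -> satisfies (graph_algebra e) (p, q).
Proof.
move=> pl ql pq v /=.
have qp : satisfies (Sc 3) (q, p) by move=> w; rewrite [LHS](esym (pq w)).
case: eval_graphP => [up|] vp; case: eval_graphP => [uq|] vq //.
- move=> uqE upE; have [pqv _] := small_identity_admissible pl pq vp.
  congr Some; apply/val_inj/setP=> i.
  by apply/idP/idP => [/upE|/uqE] [x xi ix]; [apply/uqE|apply/upE];
    exists x; rewrite // (pqv, =^~ pqv).
- by have [_ /vq] := small_identity_admissible pl pq vp.
- by have [_ /vp] := small_identity_admissible ql qp vq.
Qed.

End SmallIdentities.

(** * Shift graphs: locally bipartite with large chromatic number *)

Lemma shift_index (T : eqType) (s t : seq T) r x :
  uniq s -> uniq t -> size s = r -> size t = r -> behead s = take r.-1 t ->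
  (0 < index x s -> index x s < r -> index x s = (index x t).+1) /\
  (index x t < r.-1 -> index x s = (index x t).+1).
Proof.
case: s => [|a s] us ut /= sr tr st; first by rewrite -sr.
(* Here [s] is [a] followed by a word [u], and [t] is [u] followed by [z]; letters of [u] stand one
   place later in [s]. *)
rewrite -{}sr /= in tr st *; case/lastP: t => [//|t z] in ut tr st *.
rewrite size_rcons in tr; case: tr => tr.
rewrite -tr -cats1 take_size_cat // in st; rewrite {}st /= in us tr *.
case/andP: us => at_ us; rewrite -cats1 index_cat.
have [<-|_] := eqVneq a x; first by rewrite (negPf at_) /=; split=> //; lia.
by move: (index_mem x t); case: ifP => xt it; split=> //; lia.
Qed.

(** Induction on [r] from the pigeonhole principle; [C] varies because the step passes to
    [{set C}]. *)
Lemma shift_monochromatic r (C : finType) :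
  exists N, forall f : seq nat -> C,
  exists s, [/\ size s = r.+2, sorted ltn s, all (fun x => x < N) s &
    f (take r.+1 s) = f (behead s)].
Proof.
elim: r C => [|r IH] C.
  exists #|C|.+1 => f.
  have /injectivePn[i [j ij fij]] :
      ~~ injectiveb (fun i : 'I_#|C|.+1 => f [:: val i]).
    by apply/negP => /injectiveP/leq_card; rewrite card_ord ltnn.
  wlog lt_ij : i j ij fij / i < j.
    move=> H; move: (ij); rewrite neq_ltn => /orP[]; first exact: H.
    by apply: H; rewrite // eq_sym.
  by exists [:: val i; val j]; split; rewrite //= ?andbT ?lt_ij ?ltn_ord.
have [N NP] := IH {set C}; exists N => f.
(* The line digraph argument: colour an r-tuple by the colours of the
   tuples extending it. *)
pose ok s := sorted ltn s && all (fun x => x < N) s.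
pose g (s : seq nat) :=
    [set c | [exists z : 'I_N, ok (rcons s z) && (f (rcons s z) == c)]].
have [s [ss so sN gs]] := NP g.
case/lastP: s ss so sN gs => [//|s y]; rewrite size_rcons => -[ss] so sN.
rewrite -cats1 take_size_cat // cats1 => gs.
have yN : y < N by move: sN; rewrite all_rcons => /andP[].
(* By [gs] this colour also lies in [g (behead (rcons s y))]; a witness [z] there prolongs the
   tuple. *)
have : f (rcons s y) \in g s.
  by rewrite inE; apply/existsP; exists (Ordinal yN); rewrite /ok /= so sN /=.
rewrite gs inE => /existsP[z /andP[/andP[]]].
case: s ss so sN {gs} => [//|a s] /= [ss] so /andP[aN sN] so' sN' /eqP fz.
exists (a :: rcons (rcons s y) z); split.
- by rewrite /= !size_rcons ss.
- move: so so'; rewrite -!cats1 /=; case: (s) => /= [|b u].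
    by move=> /andP[-> _].
  by move=> /andP[-> _].
- by rewrite /= aN sN'.
- by rewrite /= fz -cats1 -ss -(size_rcons s y) take_size_cat.
Qed.

Definition shift_rel n (w : 'I_n -> seq nat) r : rel 'I_n :=
  [rel i j | (behead (w i) == take r (w j)) || (behead (w j) == take r (w i))].

Lemma shift_rel_sym n (w : 'I_n -> seq nat) r : symmetric (shift_rel w r).
Proof. by move=> i j; rewrite /shift_rel /= orbC. Qed.

Section ShiftGraph.

Variables (n l : nat) (w : 'I_n -> seq nat).
Hypotheses (w_uniq : forall i, uniq (w i)).
Hypotheses (w_size : forall i, size (w i) = l.*2.+1).

Local Notation e := (shift_rel w l.*2).

(** Only a letter at an end position, 0 or [l.*2], can drop out in a shift. *)
Lemma shift_rel_index i j x : e i j -> 0 < index x (w i) < l.*2 ->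
  index x (w i) = (index x (w j)).+1 \/ index x (w j) = (index x (w i)).+1.
Proof.
case/orP=> /eqP ij /andP[i0 i2].
  left; case: (shift_index x (w_uniq i) (w_uniq j) (w_size i) (w_size j) ij).
  by move=> + _; apply=> //; lia.
right; case: (shift_index x (w_uniq j) (w_uniq i) (w_size j) (w_size i) ij).
by move=> _; apply.
Qed.

(** Here [k] bounds the distance from the middle position; while it is below [l], the letter is
    interior and the next edge moves it by one. *)
Lemma shift_path_index x k i p : path e i p -> k + size p < l ->
  l - k <= index x (w i) <= l + k ->
  l - (k + size p) <= index x (w (last i p)) <= l + (k + size p).
Proof.
elim: p i k => [|j p IH] i k /=; first by rewrite addn0.
case/andP=> ij jp kl ik; rewrite -addSnnS; apply: IH => //; first lia.
by have [||] := shift_rel_index (x := x) ij; lia.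
Qed.

(* On a component of at most l vertices the middle letter x of one vertex never
   leaves the others, and each edge moves it by one position, so the parity of
   its position is a proper 2-colouring. *)
Lemma shift_locally_bipartite : locally_bipartite e l.
Proof.
move=> S Sl; pose eS := [rel i j | [&& i \in S, j \in S & e i j]].
have eS_sym : connect_sym eS.
  by apply: sym_connect_sym => i j /=; rewrite andbCA shift_rel_sym.
pose x i := nth 0 (w (root eS i)) l.
have xP i : i \in S -> 0 < index (x i) (w i) < l.*2.
  move=> iS; have := connect_root eS i; rewrite eS_sym => /connectP[p0 p0p ip0].
  (* The shortened path has distinct vertices, all in [S], hence fewer than [l] edges. *)
  case/shortenP: p0p ip0 => p pp up _ ip.
  have pS : {subset root eS i :: p <= S}.
    have allS : all (mem S) p.
      by elim: (p) (root _ _) pp => //= j q IH k /andP[/and3P[_ -> _] /IH].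
    move=> k; rewrite inE => /orP[/eqP ->|/(allP allS)//].
    by case: (p) pp ip => [_ /= <- //|j q /= /andP[/and3P[]]].
  have pl : @size 'I_n p < l.
    rewrite (leq_trans _ Sl) //.
    by apply: (leq_trans _ (subset_leq_card (introT subsetP pS)));
      rewrite (card_uniqP up).
  have pe : path e (root eS i) p by apply: sub_path pp => j k /and3P[].
  have xr : index (x i) (w (root eS i)) = l.
    by rewrite index_uniq ?w_uniq ?w_size //; lia.
  have := shift_path_index (x := x i) (k := 0) pe pl.
  by rewrite -ip xr subn0 addn0 leqnn add0n => /(_ isT)/andP[]; lia.
exists (fun i => odd (index (x i) (w i))) => i j iS jS ij.
have -> : x j = x i.
  congr (nth 0 (w _) l); apply/esym/(rootP eS_sym)/connect1.
  by rewrite /= iS jS.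
by case: (shift_rel_index ij (xP i iS)) => -> /=; case: odd.
Qed.

End ShiftGraph.

Lemma locally_bipartite_graph_exists l m : 0 < m ->
  exists n (e : rel 'I_n), [/\ symmetric e, locally_bipartite e l &
    forall f : 'I_n -> 'I_m, exists i j, e i j /\ f i = f j].
Proof.
move=> m0; have [N NP] := shift_monochromatic l.*2 'I_m.
(* The vertices: increasing tuples of length [l.*2.+1] below [N], obtained as subsequences of
   [iota 0 N]. *)
pose L := [seq s <- [seq mask b (iota 0 N) | b : N.-tuple bool]
  | size s == l.*2.+1].
have LP s : s \in L = (size s == l.*2.+1) && subseq s (iota 0 N).
  rewrite mem_filter; congr (_ && _).
  apply/imageP/subseqP => [[b _ ->]|[b bN ->]].
    by exists b => //; rewrite size_tuple size_iota.
  rewrite size_iota in bN.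
  by exists (tcast bN (in_tuple b)); rewrite ?val_tcast.
pose w (i : 'I_(size L)) := nth [::] L i.
have wL i : w i \in L by apply: mem_nth.
exists (size L), (shift_rel w l.*2); split.
- exact: shift_rel_sym.
- apply: shift_locally_bipartite => i; have := wL i;
    rewrite LP => /andP[/eqP //].
  by move=> _ /subseq_uniq; apply; apply: iota_uniq.
(* Lists that are not vertices get an arbitrary colour. *)
move=> f; pose h s := if insub (index s L) is Some i then f i else Ordinal m0.
have hw s : s \in L -> exists2 i, w i = s & h s = f i.
  move=> sL; have iL : index s L < size L by rewrite index_mem.
  exists (Ordinal iL); first by rewrite /w /= nth_index.
  by rewrite /h insubT.
have [s [ss so sN hs]] := NP h.
have sI : subseq s (iota 0 N).
  have -> : s = [seq x <- iota 0 N | x \in s].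
    apply: (irr_sorted_eq ltn_trans ltnn) => //.
      by apply: sorted_filter (iota_ltn_sorted _ _); apply: ltn_trans.
    move=> x; rewrite mem_filter mem_iota /= add0n.
    by case xs: (x \in s) => //=; rewrite (allP sN).
  exact: filter_subseq.
have [|i wi fi] := hw (take l.*2.+1 s).
  by rewrite LP size_take ss ltnSn eqxx (subseq_trans (take_subseq _ _)).
have [|j wj fj] := hw (behead s).
  by rewrite LP size_behead ss eqxx -drop1 (subseq_trans (drop_subseq _ _)).
exists i, j; rewrite -fi -fj /shift_rel /=; split=> //.
by rewrite wi wj; case: (s) => //= a u; rewrite eqxx.
Qed.

(** * The sum of the edges of a graph *)

Fixpoint edge_sum (x y : nat) (s : seq (nat * nat)) : term :=
  if s is (x', y') :: s' then Add (Mul (Var x) (Var y)) (edge_sum x' y' s')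
  else Mul (Var x) (Var y).

Lemma edge_edge_sum x y s a b :
  edge (edge_sum x y s) a b = ((a, b) \in (x, y) :: s).
Proof.
elim: s x y => [|[x' y'] s IH] x y; first by rewrite /= !inE.
by rewrite [LHS]/= IH /= !inE -pair_eqE.
Qed.

Lemma vars_edge_sum x y s a : a \in vars (edge_sum x y s) ->
  exists b, edge (edge_sum x y s) a b || edge (edge_sum x y s) b a.
Proof.
elim: s x y => [|[x' y'] s IH] x y /=; rewrite !inE.
  by case/orP=> /eqP ->; [exists y|exists x]; rewrite !inE !eqxx ?orbT.
case/or3P=> [/eqP ->|/eqP ->|/IH[b]].
- by exists y; rewrite !inE !eqxx.
- by exists x; rewrite !inE !eqxx orbT.
- by case/orP=> ab; exists b; rewrite ab ?orbT.
Qed.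

Lemma non_colorable_term n (e : rel 'I_n) m :
  (forall f : 'I_n -> 'I_m, exists i j, e i j /\ f i = f j) -> 0 < m ->
  exists t, [/\ forall i j : 'I_n, e i j -> edge t i j,
    forall x y, edge t x y -> exists i j : 'I_n, [/\ x = i, y = j & e i j] &
    forall x, x \in vars t -> exists i : 'I_n, x = i].
Proof.
(* A constant colouring yields an edge to start the sum, as there is no constant for an empty
   one. *)
move=> chi m0; have [i0 [j0 [ij0 _]]] := chi (fun=> Ordinal m0).
pose E : seq (nat * nat) := [seq (val ij.1, val ij.2) |
  ij <- enum {: 'I_n * 'I_n} & e ij.1 ij.2].
have EP x y : edge (edge_sum i0 j0 E) x y ->
    exists i j : 'I_n, [/\ x = i, y = j & e i j].
  rewrite edge_edge_sum inE => /orP[/eqP[-> ->]|]; first by exists i0, j0.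
  case/mapP=> -[i j]; rewrite mem_filter => /andP[/= ij _] [-> ->].
  by exists i, j.
exists (edge_sum i0 j0 E); split=> // [i j ij|x /vars_edge_sum[y]].
  rewrite edge_edge_sum inE; apply/orP; right; apply/mapP.
  by exists (i, j); rewrite // mem_filter /= ij mem_enum.
by case/orP=> /EP[i [j [xi yj _]]]; [exists i|exists j].
Qed.

(** * Refuting a finite basis *)

Theorem theorem10p1 (k m : nat) (hk : 3 <= k) (hkm : k <= m)
    (W : algebra -> Prop)
    (hW : in_interval (variety_of (Sc k)) (variety_of (Sc m)) W) :
  ~ finitely_based W.
Proof.
case: hW => _ SkW WSm [Sigma [SigmaW WSigma]].
have m0 : 0 < m by lia.
have Sigma3 e : List.In e Sigma -> satisfies (Sc 3) e.
  move=> /SigmaW; apply.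
  by apply: SkW (Sc_variety_mono hk (@variety_of_self _)).
have [l lP] : exists l, forall e, List.In e Sigma ->
    size (vars e.1) <= l /\ size (vars e.2) <= l.
  elim: Sigma {SigmaW WSigma Sigma3} => [|e Sigma [l lP]]; first by exists 0.
  exists (size (vars e.1) + size (vars e.2) + l) => e' /= [<-|/lP]; lia.
(* With [l.+1], singletons are covered even if [l] is 0, which excludes loops. *)
have [n [e [e_sym e_bip chi]]] := locally_bipartite_graph_exists l.+1 m0.
have e_irr i : ~~ e i i.
  have [|b bP] := e_bip [set i]; first by rewrite cards1.
  by apply/negP=> /(bP _ _ (set11 i) (set11 i)); rewrite eqxx.
have [t [te et tv]] := non_colorable_term chi m0.
have tt : identity_of W (t, Mul t t).
  move=> A /WSm; apply: variety_of_satisfies => v /=.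
  (* Choosing a letter from each support would properly colour the graph with [m] colours. *)
  have tN : ~ admissible [rel i j | i != j] v t.
    case=> t1 t2.
    pose f (i : 'I_n) := odflt (Ordinal m0) [pick c in supp (v i)].
    have fP (i : 'I_n) : val i \in vars t -> f i \in supp (v i).
      move=> /t1/set0Pn[c cv]; rewrite /f; case: pickP => //= v0.
      by have := v0 c; rewrite cv.
    have [i [j [ij fij]]] := chi f; have [it jt] := edge_vars (te _ _ ij).
    by have := t2 _ _ (te _ _ ij) _ _ (fP _ it) (fP _ jt); rewrite /= fij eqxx.
  by case: eval_ScP => [u /tN|].
have Ge : satisfies (graph_algebra e) (t, Mul t t).
  apply: (WSigma _ tt) => -[p q] pq; have [pl ql] := lP _ pq.
  by apply: (graph_algebra_small_identity e_sym e_bip);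
    [exact: leqW|exact: leqW|exact: Sigma3].
(* Each vertex goes to its own singleton: [t] is nonzero, while [Mul t t] would need a loop. *)
pose v x : graph_algebra e := if insub x is Some i then letter i else None.
have vE (i : 'I_n) : supp (v i) = [set i] by rewrite /v valK.
have tv_ok : admissible e v t.
  split=> [x /tv[i ->]|x y /et[i [j [-> -> ij]]] i' j'].
    by rewrite vE; apply: set1_neq0.
  by rewrite !vE !inE => /eqP -> /eqP ->.
have [i [j [ij _]]] := chi (fun=> Ordinal m0).
have [it _] := edge_vars (te _ _ ij).
have := Ge v; case: eval_graphP => // u _ _.
case: eval_graphP => // _ [_ t2] _ _.
have /(t2 _ _) : edge (Mul t t) i i by rewrite /= it !orbT.
by rewrite vE => /(_ i i (set11 i) (set11 i)); apply/negP.
Qed.
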